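(* Let $a$ be a weak composition with exactly two nonzero parts and exactly one leading zero (that is, $a_1=0\neq a_2$). Then $\kappa_a$ is multiplicity free if and only if either (1) $\mathrm{sort}(a)$ is one of the partitions $(3,3)$, $(4,4)$, $(n-2,2)$ for some $n\ge 4$, or $(n-1,1)$ for some $n\ge 2$; or (2) $\mathrm{flat}(a)=(\alpha_1,\alpha_2)$ with $\alpha_1\ge\alpha_2$.
   Context: A weak composition $a=(a_1,\dots,a_\ell)$ of length $\ell$ is a finite sequence of nonnegative integers. $\mathrm{flat}(a)$ is the sequence obtained by deleting the zeros of $a$, and $\mathrm{sort}(a)$ is the partition obtained by rearranging the parts of $\mathrm{flat}(a)$ in weakly decreasing order. A diagram is a finite set of cells $(r,c)$ with $r,c$ positive integers (row $r$ from the bottom, column $c$ from the left). A Kohnert tableau of content $a$ is a diagram filled with positive integers, exactly $a_i$ cells containing $i$ for each $i$, such that: (i) for each $i$ there is exactly one $i$ in each of the columns $1,\dots,a_i$; (ii) every entry in row $r$ is at least $r$; (iii) for each $i$, the cells containing $i$ weakly descend from left to right; (iv) if $i<j$ appear in the same column with $i$ above $j$, then there is an $i$ in the column immediately to the right of the cell containing that $j$, in a row strictly above it. It is quasi-Yamanouchi if moreover (v) for each nonempty row $r$, either row $r$ contains an entry equal to $r$, or some cell of row $r+1$ lies weakly to the right of some cell of row $r$. Let $\mathrm{QKT}(a)$ be the set of quasi-Yamanouchi Kohnert tableaux of content $a$, and $\mathrm{wt}(T)$ the weak composition of length $\ell$ whose $r$-th part is the number of cells in row $r$ of $T$. The key polynomial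 $\kappa_a$ satisfies $\kappa_a=\sum_{T\in\mathrm{QKT}(a)}\mathfrak{F}_{\mathrm{wt}(T)}$, where $\mathfrak{F}_b$ is the fundamental slide polynomial. We say $\kappa_a$ is multiplicity free if distinct tableaux in $\mathrm{QKT}(a)$ have distinct weights. *)

(* Defs.v *)
From mathcomp Require Import all_boot finmap.

Set Implicit Arguments.
Unset Strict Implicit.
Unset Printing Implicit Defensive.

Local Open Scope fset_scope.
Local Open Scope fmap_scope.
Local Open Scope nat_scope.

(* A weak composition of length l is a [seq nat] of size l; parts are numbered
   from 1, so [part a i] is a_i and is 0 when i is outside 1..l. *)
Definition part (a : seq nat) (i : nat) : nat :=
  if i is i'.+1 then nth 0 a i' else 0.

Definition flat (a : seq nat) : seq nat := [seq x <- a | x != 0].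

Definition sort_comp (a : seq nat) : seq nat := sort geq (flat a).

(* A filling of a diagram: the finite domain is the set of cells (r, c), with
   row r counted from the bottom and column c from the left, both from 1. *)
Definition filling := {fmap nat * nat -> nat}.

Definition entry (T : filling) (r c i : nat) : Prop := T.[? (r, c)] = Some i.

Definition positive_filling (T : filling) : Prop :=
  forall r c i, entry T r c i -> [/\ 0 < r, 0 < c & 0 < i].

Definition has_content (T : filling) (a : seq nat) : Prop :=
  forall i, 0 < i -> #|` [fset x in domf T | T.[? x] == Some i]| = part a i.

Record kohnert_tableau (a : seq nat) (T : filling) : Prop := KohnertTableau {
  kt_positive : positive_filling T;
  kt_content : has_content T a;
  kt_columns : forall i c, 0 < i -> 0 < c <= part a i ->
    exists! r, entry T r c i;
  kt_flagged : forall r c i, entry T r c i -> r <= i;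
  kt_descend : forall i r c r' c', entry T r c i -> entry T r' c' i ->
    c < c' -> r' <= r;
  kt_inversion : forall i j c ri rj, i < j ->
    entry T ri c i -> entry T rj c j -> rj < ri ->
    exists2 r, rj < r & entry T r c.+1 i
}.

Definition quasi_yamanouchi (T : filling) : Prop :=
  forall r, (exists c, (r, c) \in domf T) ->
    (exists c, entry T r c r) \/
    (exists c c', [/\ (r, c) \in domf T, (r.+1, c') \in domf T & c <= c']).

Definition QKT (a : seq nat) (T : filling) : Prop :=
  kohnert_tableau a T /\ quasi_yamanouchi T.

Definition wt (l : nat) (T : filling) : seq nat :=
  [seq #|` [fset x in domf T | x.1 == r]| | r <- iota 1 l].

(* The expansion of the key polynomial of a into fundamental slide polynomials
   is the sum over T in QKT(a) of the slide polynomial indexed by wt(T), so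
   multiplicity freeness says that wt is injective on QKT(a). *)
Definition key_multiplicity_free (a : seq nat) : Prop :=
  forall T T', QKT a T -> QKT a T' -> wt (size a) T = wt (size a) T' -> T = T'.

(* Main.v *)
Require Import Defs.
From mathcomp Require Import all_boot finmap.
From mathcomp Require Import zify.

(* Say a has the parts p in position 2 and q in position k > 2.  A tableau in
   QKT(a) is determined by three thresholds x, y, z: the 2s lie in row 2 up to
   column x and then in row 1; the ks lie in row k up to column y, then in row 2
   up to column z, then in row 1.  No k can lie strictly between rows 2 and k,
   by the quasi-Yamanouchi condition.  The weight determines y and the size
   x + (z - y) of row 2.  If q <= p or p <= 2, the constraints on x and z make
   their sum determine both; if 2 < p < q, the thresholds (2, 2, q - 1) and
   (1, 2, q) give two tableaux of the same weight. *)

Set Implicit Arguments.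
Unset Strict Implicit.
Unset Printing Implicit Defensive.

(** * Fillings given by the row of each label in each column *)

(** [rho i c] is the row of label [i] in column [c]; only its values with [0 < c <= part a i]
    matter. *)
Definition has_rows (a : seq nat) (T : filling) (rho : nat -> nat -> nat) :=
  forall r c i,
    entry T r c i <-> [/\ 0 < i, 0 < c <= part a i & r = rho i c].

Definition label_cells (a : seq nat) (rho : nat -> nat -> nat) i :=
  [seq (rho i c, c) | c <- iota 1 (part a i)].

Definition row_cells (a : seq nat) (rho : nat -> nat -> nat) :=
  flatten [seq label_cells a rho i | i <- iota 1 (size a)].

Lemma part_gt0 a i : 0 < part a i -> 0 < i <= size a.
Proof.
case: i => [|i] //= ai_gt0; rewrite ltnNge.
by apply/negP=> le_a_i; rewrite nth_default in ai_gt0.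
Qed.

Lemma in_domf (T : filling) x :
  reflect (exists i, T.[? x]%fmap = Some i) (x \in domf T).
Proof.
apply: (iffP idP) => [xT | [i Tx]]; first by exists T.[xT]%fmap; rewrite in_fnd.
by rewrite -fndSome Tx.
Qed.

Lemma entry_inj (T : filling) r c i j : entry T r c i -> entry T r c j -> i = j.
Proof. by rewrite /entry => -> []. Qed.

Lemma uniq_label_cells a rho i : uniq (label_cells a rho i).
Proof. by rewrite map_inj_uniq ?iota_uniq // => c c' []. Qed.

Lemma label_cellsP a rho i r c :
  reflect (0 < c <= part a i /\ r = rho i c) ((r, c) \in label_cells a rho i).
Proof.
apply: (iffP mapP) => [[c'] | [c_le ->]].
  by rewrite mem_iota => c'_in [-> ->]; split=> //; lia.
by exists c => //; rewrite mem_iota; lia.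
Qed.

Lemma row_cellsP a rho r c :
  reflect (exists i, [/\ 0 < i, 0 < c <= part a i & r = rho i c])
          ((r, c) \in row_cells a rho).
Proof.
apply: (iffP flatten_mapP) => [[i] | [i [i_gt0 c_le ->]]].
  by rewrite mem_iota => i_in /label_cellsP[c_le ->]; exists i; split=> //; lia.
exists i; last exact/label_cellsP.
have: 0 < part a i by lia.
by move/part_gt0; rewrite mem_iota; lia.
Qed.

Lemma card_seq_eq (A : {fset nat * nat}%fset) (s : seq (nat * nat)) :
  uniq s -> A =i s -> #|` A|%fset = size s.
Proof. by move=> s_uniq eqAs; apply/perm_size/uniq_perm; rewrite ?fset_uniq. Qed.

(** The column condition supplies an [i] in each of the columns 1 to [part a i]; the content
    condition then leaves no room for an [i] in any other column. *)
Lemma kohnert_has_rows a T :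
  kohnert_tableau a T -> exists rho, has_rows a T rho.
Proof.
move=> ktT.
(* The row of the first cell found in column [c] with entry [i], and 0 if there is none. *)
pose rho i c :=
  (head (0, 0) [seq x <- enum_fset (domf T) |
                (x.2 == c) && (T.[? x]%fmap == Some i)]).1.
have rhoP r c i : entry T r c i -> entry T (rho i c) c i.
  move=> Ti; have: (r, c) \in [seq x <- enum_fset (domf T) |
                (x.2 == c) && (T.[? x]%fmap == Some i)].
    rewrite mem_filter /= eqxx Ti eqxx /=; apply/in_domf; by exists i.
  rewrite /rho; case E: filter => [//|x s] _ /=.
  have: x \in x :: s by rewrite mem_head.
  rewrite -E mem_filter => /andP[/andP[/eqP <- /eqP]] /=.
  by rewrite /entry -surjective_pairing.
have rho_col c i : 0 < i -> 0 < c <= part a i -> entry T (rho i c) c i.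
  by move=> i_gt0 c_le; case: (kt_columns ktT i_gt0 c_le) => r [/rhoP].
have cellsE i : 0 < i ->
    [fset x in domf T | T.[? x]%fmap == Some i]%fset =i label_cells a rho i.
  move=> i_gt0.
  have /fset_eqP sub : [fset x in label_cells a rho i]%fset ==
                  [fset x in domf T | T.[? x]%fmap == Some i]%fset.
    rewrite eqEfcard; apply/andP; split.
      apply/fsubsetP=> -[r c]; rewrite !inE /= => /label_cellsP[c_le ->].
      have Ti := rho_col c i i_gt0 c_le.
      by rewrite Ti eqxx andbT; apply/in_domf; exists i.
    rewrite (kt_content ktT) // (@card_seq_eq _ (label_cells a rho i)).
    - by rewrite size_map size_iota.
    - exact: uniq_label_cells.
    - by move=> x; rewrite !inE.
  by move=> x; rewrite -sub !inE.
exists rho => r c i; split=> [Ti | [i_gt0 c_le ->]]; last exact: rho_col.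
have [_ _ i_gt0] := kt_positive ktT Ti.
have: (r, c) \in [fset x in domf T | T.[? x]%fmap == Some i]%fset.
  by rewrite !inE /= Ti eqxx andbT; apply/in_domf; exists i.
by rewrite cellsE // => /label_cellsP[].
Qed.

(** * Uniqueness, content and row sizes of a filling with given rows *)

Section Rows.
Variables (a : seq nat) (rho : nat -> nat -> nat).

Lemma has_rows_eq T T' : has_rows a T rho -> has_rows a T' rho -> T = T'.
Proof.
move=> hT hT'; apply/fmapP=> -[r c].
case E: T.[? _]%fmap => [i|].
  by have /hT/hT' : entry T r c i by [].
case E': T'.[? _]%fmap => [i|//].
by have /hT'/hT : entry T' r c i by []; rewrite /entry E.
Qed.

Lemma has_rows_ext rho' T : has_rows a T rho ->
  (forall i c, 0 < i -> 0 < c <= part a i -> rho i c = rho' i c) ->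
  has_rows a T rho'.
Proof.
move=> hT eq_rho r c i; split=> [/hT[i_gt0 c_le ->] | [i_gt0 c_le ->]].
  by split=> //; apply: eq_rho.
by apply/hT; split=> //; rewrite eq_rho.
Qed.

Variable (T : filling).
Hypothesis hT : has_rows a T rho.

Lemma has_rows_inj i j c : 0 < i -> 0 < j ->
  0 < c <= part a i -> 0 < c <= part a j -> rho i c = rho j c -> i = j.
Proof.
move=> i_gt0 j_gt0 ci cj eq_rho.
apply: (@entry_inj T (rho i c) c); apply/hT; split=> //.
Qed.

Lemma domf_has_rows : domf T =i row_cells a rho.
Proof.
move=> [r c]; apply/in_domf/row_cellsP => -[i /hT iP]; by exists i.
Qed.

(** Different labels occupy disjoint sets of cells, since [T] has one entry per cell. This lets row
    sizes be counted label by label. *)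
Lemma uniq_row_cells : uniq (row_cells a rho).
Proof.
rewrite /row_cells.
have: {subset iota 1 (size a) <= [pred i | 0 < i]}.
  by move=> i; rewrite mem_iota !inE; lia.
elim: iota (iota_uniq 1 (size a)) => //= i s IHs /andP[i_notin s_uniq] s_gt0.
rewrite cat_uniq uniq_label_cells IHs ?andbT //=; last first.
  by move=> j j_s; apply: s_gt0; rewrite inE j_s orbT.
apply/hasPn=> -[r c] /flatten_mapP[j j_s /label_cellsP[cj ->]].
apply/negP=> /label_cellsP[ci eq_rho].
move/negP: i_notin; apply.
rewrite (has_rows_inj _ _ ci cj) //; first by apply: s_gt0; rewrite mem_head.
by apply: s_gt0; rewrite inE j_s orbT.
Qed.

Lemma has_rows_content : has_content T a.
Proof.
move=> i i_gt0; rewrite (@card_seq_eq _ (label_cells a rho i)).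
- by rewrite size_map size_iota.
- exact: uniq_label_cells.
move=> [r c]; rewrite !inE /=; apply/andP/label_cellsP => [[_ /eqP /hT[]] // | [c_le ->]].
have Ti : entry T (rho i c) c i by apply/hT.
by split; [apply/in_domf; exists i | rewrite Ti].
Qed.

Lemma card_row r :
  #|` [fset x in domf T | x.1 == r]|%fset =
  \sum_(i <- iota 1 (size a)) count (fun c => rho i c == r) (iota 1 (part a i)).
Proof.
rewrite (@card_seq_eq _ [seq x <- row_cells a rho | x.1 == r]).
- rewrite size_filter count_flatten sumnE !big_map.
  by apply: eq_bigr => i _; rewrite count_map.
- by rewrite filter_uniq // uniq_row_cells.
by move=> x; rewrite !inE mem_filter domf_has_rows andbC.
Qed.

End Rows.

(** Each cell of [row_cells] then belongs to exactly one label, so the first label found by [lab] is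
    the right entry. *)
Lemma has_rows_exists a rho :
  (forall i j c, 0 < i < j -> 0 < c <= part a i -> 0 < c <= part a j ->
     rho i c <> rho j c) ->
  exists T, has_rows a T rho.
Proof.
move=> rho_neq.
pose lab (x : nat * nat) :=
  head 0 [seq i <- iota 1 (size a) | x \in label_cells a rho i].
pose D := [fset x in row_cells a rho]%fset.
exists [fmap x : D => lab (val x)]%fmap.
have labP r c i : 0 < i -> 0 < c <= part a i -> r = rho i c -> lab (r, c) = i.
  move=> i_gt0 c_le ->.
  have: i \in [seq j <- iota 1 (size a) | (rho i c, c) \in label_cells a rho j].
    rewrite mem_filter mem_iota; apply/andP; split; first exact/label_cellsP.
    by have /part_gt0: 0 < part a i; lia.
  rewrite /lab; case E: filter => [//|j s] _ /=.
  have: j \in j :: s by rewrite mem_head.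
  rewrite -E mem_filter mem_iota => /andP[/label_cellsP[cj eq_rho] j_in].
  case: (ltngtP i j) => // ij.
    by case: (rho_neq i j c) => //; lia.
  by case: (rho_neq j i c) => //; lia.
have memD r c : reflect (exists i, [/\ 0 < i, 0 < c <= part a i & r = rho i c])
    ((r, c) \in D).
  by rewrite inE; apply: row_cellsP.
move=> r c i; rewrite /entry; split.
  case: (boolP ((r, c) \in D)) => [rcD | rcND]; last by rewrite not_fnd.
  rewrite in_fnd ffunE /= => -[<-].
  by have /memD[j [j_gt0 cj ->]] := rcD; rewrite (labP _ _ j).
move=> iP; have rcD : (r, c) \in D by apply/memD; exists i.
by rewrite in_fnd ffunE /= (labP _ _ i) //; case: iP.
Qed.

(** * Two nonzero parts, the first in position 2 *)

Definition two_rows k x y z i c :=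
  if i == 2 then (if c <= x then 2 else 1)
  else if c <= y then k else if c <= z then 2 else 1.

(** Rows of a label weakly descend, so lying above a given row is a property of an initial segment
    of columns; [x], [y] and [z] arise this way. *)
Lemma threshold (P : pred nat) n :
  (forall c c', 0 < c' < c -> c <= n -> P c -> P c') ->
  exists2 x, x <= n & forall c, 0 < c <= n -> P c = (c <= x).
Proof.
elim: n => [|n IHn] P_down; first by exists 0 => // c; lia.
case: (boolP (P n.+1)) => [Pn | NPn].
  exists n.+1 => // c c_le; have -> : c <= n.+1 by lia.
  have [->//|] := eqVneq c n.+1 => c_neq; apply: (P_down n.+1) => //; lia.
have [|x x_le xP] := IHn.
  move=> c c' c'_lt c_le; apply: P_down => //; lia.
exists x => [|c c_le]; first lia.
have [->|c_neq] := eqVneq c n.+1; last by apply: xP; lia.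
by rewrite (negbTE NPn); lia.
Qed.

Lemma count_const (P : pred nat) (b : bool) m n :
  (forall c, m <= c < m + n -> P c = b) -> count P (iota m n) = b * n.
Proof.
move=> Pb; rewrite (@eq_in_count _ _ (fun=> b)).
  by case: b {Pb}; rewrite ?count_predT ?count_pred0 ?size_iota ?mul1n ?mul0n.
by move=> c; rewrite mem_iota; apply: Pb.
Qed.

Arguments part : simpl never.

Local Ltac split_ifs :=
  repeat match goal with |- context [if ?b then _ else _] =>
    case: (boolP b) => ?
  end.

Section TwoParts.
Variables (a : seq nat) (k : nat).
Hypotheses (k_gt2 : 2 < k) (a2_gt0 : 0 < part a 2) (ak_gt0 : 0 < part a k).
Hypothesis a_supp : forall i, i != 2 -> i != k -> part a i = 0.
Let p := part a 2.
Let q := part a k.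

Lemma label_two_parts i c : 0 < c <= part a i -> i = 2 \/ i = k.
Proof.
have [->|i_neq2] := eqVneq i 2; first by left.
have [->|i_neqk] := eqVneq i k; first by right.
by rewrite a_supp //; lia.
Qed.

Lemma two_rows_2 x y z c : two_rows k x y z 2 c = if c <= x then 2 else 1.
Proof. by []. Qed.

Lemma two_rows_k x y z c :
  two_rows k x y z k c = if c <= y then k else if c <= z then 2 else 1.
Proof. by rewrite /two_rows; have -> : (k == 2) = false by lia. Qed.

(** Each label keeps its row on consecutive blocks of columns: lengths [x], [p - x] for 2 and [y],
    [z - y], [q - z] for [k]. The booleans select the blocks in row [r]. *)
Lemma card_two_rows T x y z r : x <= p -> y <= z <= q ->
  has_rows a T (two_rows k x y z) ->
  #|` [fset x in domf T | x.1 == r]|%fset =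
  (2 == r) * x + (1 == r) * (p - x) +
  ((k == r) * y + (2 == r) * (z - y) + (1 == r) * (q - z)).
Proof.
move=> x_le yz_le hT; rewrite (card_row hT).
have := part_gt0 a2_gt0; have := part_gt0 ak_gt0 => k_le two_le.
rewrite (bigD1_seq 2) ?iota_uniq ?mem_iota //=.
rewrite -big_filter (bigD1_seq k) ?filter_uniq ?iota_uniq //=; last first.
  by rewrite mem_filter mem_iota; lia.
rewrite big_filter_cond big1 => [|i /andP[i_neq2 i_neqk]]; last first.
  by rewrite a_supp.
rewrite addn0; congr (_ + _).
  have {1}-> : part a 2 = x + (p - x) by rewrite subnKC.
  rewrite iotaD count_cat.
  congr (_ + _); apply: count_const => c c_in; rewrite two_rows_2; case: leqP; lia.
have {1}-> : part a k = y + (z - y) + (q - z) by rewrite -/q; lia.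
rewrite !iotaD !count_cat.
by congr (_ + _ + _); apply: count_const => c c_in; rewrite two_rows_k;
  do 2?case: leqP => ? //; lia.
Qed.

(* The last clause says that row 1, if nonempty, satisfies the
   quasi-Yamanouchi condition; the clause before it is the inversion
   condition for the last 2 of row 2. *)
Definition admissible x y z :=
  [/\ 0 < x <= p, y <= z <= q, y < z -> x <= y,
      minn p q <= maxn x z &
      (z < x -> q < x) /\
      (x < p \/ z < q -> exists c c',
        [/\ (x < c <= p) || (z < c <= q),
            (0 < c' <= x) || (y < c' <= z) & c <= c'])].

Lemma QKT_two_rows T : QKT a T ->
  exists x y z, admissible x y z /\ has_rows a T (two_rows k x y z).
Proof.
move=> [ktT qyT]; have [rho hT] := kohnert_has_rows ktT.
have ent2 c : 0 < c <= p -> entry T (rho 2 c) c 2 by move=> ?; apply/hT.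
have entk c : 0 < c <= q -> entry T (rho k c) c k by move=> ?; apply/hT; split=> //; lia.
have domP r c : (r, c) \in domf T ->
    (0 < c <= p /\ r = rho 2 c) \/ (0 < c <= q /\ r = rho k c).
  case/in_domf=> i /hT[_ c_le ->].
  by case: (label_two_parts c_le) => i_eq; [left | right]; subst i.
have pos2 c : 0 < c <= p -> 0 < rho 2 c.
  by move=> /ent2 /(kt_positive ktT)[].
have posk c : 0 < c <= q -> 0 < rho k c.
  by move=> /entk /(kt_positive ktT)[].
have le2 c : 0 < c <= p -> rho 2 c <= 2 by move=> /ent2/(kt_flagged ktT).
have lek c : 0 < c <= q -> rho k c <= k by move=> /entk/(kt_flagged ktT).
have desc2 c c' : 0 < c -> c <= c' -> c' <= p -> rho 2 c' <= rho 2 c.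
  move=> c_gt0; rewrite leq_eqVlt => /orP[/eqP->//|lt_c] c'_le.
  by apply: (kt_descend ktT (i := 2) _ _ lt_c); apply: ent2; lia.
have desck c c' : 0 < c -> c <= c' -> c' <= q -> rho k c' <= rho k c.
  move=> c_gt0; rewrite leq_eqVlt => /orP[/eqP->//|lt_c] c'_le.
  by apply: (kt_descend ktT (i := k) _ _ lt_c); apply: entk; lia.
have neq c : 0 < c <= p -> 0 < c <= q -> rho 2 c <> rho k c.
  by move=> cp cq /(has_rows_inj hT) E; have := E isT _ cp cq; lia.
(* A k in row r + 1 lies strictly to the left of every k in row r, so a row
   with only ks would violate the quasi-Yamanouchi condition unless r = k. *)
have gap r c : 1 < r < k -> (r, c) \in domf T ->
    (exists2 c', 0 < c' <= p & 2 = rho 2 c') /\ r = 2.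
  move=> r_in rcT; case: (qyT r) => [|[c' /hT[_ c'_le r_eq]]|]; first by exists c.
    case: (label_two_parts c'_le) => r_eq'; subst r; last lia.
    by split=> //; exists c'.
  move=> [c1 [c2 [/domP d1 /domP d2 le_c]]].
  case: d2 => -[c2_le r2].
    by have := le2 c2 c2_le; lia.
  case: d1 => -[c1_le r1].
    have r_eq : r = 2 by have := le2 c1 c1_le; lia.
    by split=> //; exists c1 => //; lia.
  by have := @desck c1 c2; lia.
(* Otherwise all 2s lie in row 1 by descent. No entry is 1, so the quasi-Yamanouchi condition needs
   a cell in row 2, and [gap] then puts a 2 there. *)
have rho21 : rho 2 1 = 2.
  have one_in : (rho 2 1, 1) \in domf T by apply/in_domf; exists 2; apply: ent2.
  have := le2 1; have := pos2 1; have one_le : 0 < 1 <= p by lia.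
  move=> /(_ one_le) gt0 /(_ one_le) le_2.
  have [//|neq2] := eqVneq (rho 2 1) 2.
  have r1 : rho 2 1 = 1 by lia.
  rewrite r1 in one_in.
  case: (qyT 1) => [|[c' /hT[_ c'_le _]]|]; first by exists 1.
    by case: (label_two_parts c'_le); lia.
  move=> [c1 [c2 [_ d2 _]]].
  have [|//|[c' c'_le r2] _] := gap 2 c2; first lia.
  have := @desc2 1 c'; lia.
have rows_k c : 0 < c <= q -> [\/ rho k c = k, rho k c = 2 | rho k c = 1].
  move=> c_le; have := lek c c_le; have := posk c c_le.
  have [->|neqk] := eqVneq (rho k c) k; first by constructor 1.
  have [->|neq1] := eqVneq (rho k c) 1; first by constructor 3.
  move=> gt0 le_k; constructor 2; apply: (gap _ c _ _).2; first lia.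
  by apply/in_domf; exists k; apply: entk.
have [x x_le xP] : exists2 x, x <= p & forall c, 0 < c <= p -> (1 < rho 2 c) = (c <= x).
  by apply: threshold => c c' lt_c c_le; have := @desc2 c' c; lia.
have [y y_le yP] : exists2 y, y <= q & forall c, 0 < c <= q -> (2 < rho k c) = (c <= y).
  by apply: threshold => c c' lt_c c_le; have := @desck c' c; lia.
have [z z_le zP] : exists2 z, z <= q & forall c, 0 < c <= q -> (1 < rho k c) = (c <= z).
  by apply: threshold => c c' lt_c c_le; have := @desck c' c; lia.
have rho2E c : 0 < c <= p -> rho 2 c = if c <= x then 2 else 1.
  by move=> c_le; move: (xP c c_le) (le2 c c_le) (pos2 c c_le); case: (leqP c x) => /=; lia.
have rhokE c : 0 < c <= q -> rho k c = if c <= y then k else if c <= z then 2 else 1.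
  move=> c_le; move: (yP c c_le) (zP c c_le).
  by case: (rows_k c c_le) => ->; case: (leqP c y); case: (leqP c z) => /=; lia.
have x_gt0 : 0 < x by have := xP 1; rewrite rho21; lia.
have le_yz : y <= z.
  by case: (posnP y) => [->//|y_gt0]; have := yP y; have := zP y; lia.
exists x, y, z; split; last first.
  apply: (has_rows_ext hT) => i c _ c_le.
  case: (label_two_parts c_le) => i_eq; subst i.
    by rewrite rho2E.
  by rewrite rhokE // two_rows_k.
split; [lia | lia | | | split].
(* If [y < x], the 2 and the [k] of column [y + 1] would share row 2. *)
- move=> lt_yz; rewrite leqNgt; apply/negP => lt_yx.
  case: (@neq y.+1); [lia | lia | rewrite rho2E ?rhokE; [|lia|lia]].
  by split_ifs; lia.
(* In column [maxn x z + 1] both labels would be in row 1. *)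
- rewrite leqNgt; apply/negP=> gt_max.
  case: (@neq (maxn x z).+1); [lia | lia | rewrite rho2E ?rhokE; [|lia|lia]].
  by split_ifs; lia.
(* In column [x] the 2 lies in row 2 above a [k] in row 1, but no 2 in column [x + 1] lies above row
   1. *)
- move=> lt_zx; rewrite ltnNge; apply/negP=> le_xq.
  have [| | |r r_gt Tr] := @kt_inversion _ _ ktT 2 k x (rho 2 x) (rho k x) k_gt2.
  + by apply: ent2; lia.
  + by apply: entk; lia.
  + by rewrite rho2E ?rhokE; [split_ifs; lia | lia | lia].
  case/hT: Tr => _ c_le r_eq; move: r_gt; rewrite r_eq rho2E ?rhokE; [|lia|lia].
  by split_ifs; lia.
- move=> row1.
  have [c row1c] : exists c, (1, c) \in domf T.
    case: row1 => [lt_xp | lt_zq].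
      exists x.+1; apply/in_domf; exists 2.
      by have := ent2 x.+1; rewrite rho2E ?ltnn; [apply; lia | lia].
    exists z.+1; apply/in_domf; exists k.
    have := entk z.+1; rewrite rhokE; last lia.
    have -> : (z < y) = false by lia.
    by rewrite ltnn; apply; lia.
  case: (qyT 1) => [|[c' /hT[_ c'_le _]]|[c1 [c2 [d1 d2 le_c]]]].
  + by exists c.
  + by case: (label_two_parts c'_le); lia.
  exists c1, c2; split=> //.
    case/domP: d1 => -[c_le]; rewrite ?rho2E ?rhokE //;
      split_ifs; lia.
  case/domP: d2 => -[c_le]; rewrite ?rho2E ?rhokE //;
    split_ifs; lia.
Qed.

(** * Comparison of tableaux of equal weight *)

(** If [z < x], then [y < z] would give [x <= y], so no [k] is in row 2. If [x <= z], the [k]s in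
    row 1 are to the right of all of row 2; so when row 1 is nonempty, its quasi-Yamanouchi pair is
    a 2 in row 1 and a [k] in row 2. *)
Lemma admissible_cases x y z : admissible x y z ->
  [\/ x = p /\ y = z /\ z = q, q < x <= p /\ y = z /\ z <= q
   | x <= y < z /\ minn p q <= z /\ (x < p \/ z = q)].
Proof.
case=> x_le yz_le y_lt min_le [z_lt row1].
case: (ltnP z x) => [lt_zx | le_xz]; first by constructor 2; lia.
case: (boolP ((x < p) || (z < q))) => [/orP/row1[c [c' [c_in c'_in le_c]]] | full].
  by constructor 3; lia.
by case: (ltnP y z) => ?; [constructor 3 | constructor 1]; lia.
Qed.

(** For equal [y], the second shape has a larger [x + z] than the third, because there [x > q].
    Within the third shape, [q <= p] forces [z = q], while [p <= 2] leaves only [x = 1], or [x = 2]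
    with [z = q], whose sum [q + 2] is out of reach for [x = 1]. *)
Lemma multiplicity_free_two_parts : q <= p \/ p <= 2 -> key_multiplicity_free a.
Proof.
move=> pq T T' /QKT_two_rows[x [y [z [adm hT]]]].
move=> /QKT_two_rows[x' [y' [z' [adm' hT']]]] /eq_in_map eq_wt.
have := part_gt0 a2_gt0; have := part_gt0 ak_gt0 => k_le two_le.
have := eq_wt k; have := eq_wt 2; rewrite !mem_iota.
case: (adm) (adm') => x_le yz_le _ _ _ [x'_le yz'_le _ _ _].
rewrite !(card_two_rows _ _ _ hT) ?(card_two_rows _ _ _ hT'); try lia.
move=> eq2 eqk; have {}eqk : y = y' by lia.
have {}eq2 : x + (z - y) = x' + (z' - y') by lia.
suff [eq_x eq_z] : x = x' /\ z = z' by subst; apply: has_rows_eq hT hT'.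
move: pq (admissible_cases adm) (admissible_cases adm') => {adm adm' hT hT' eq_wt}.
case=> pq [] ? [] ?; lia.
Qed.

(** In each column with both labels the [k] is strictly above the 2: it is in row [k] up to [y], and
    from there to [z >= p] it is in row 2 with the 2 in row 1. Hence there are no collisions and the
    inversion condition is vacuous. *)
Lemma two_rows_QKT x y z : 0 < x < p -> x <= y < z -> z <= q -> p <= z ->
  exists2 T, QKT a T & has_rows a T (two_rows k x y z).
Proof.
move=> x_in y_in z_le p_le.
have [|T hT] := @has_rows_exists a (two_rows k x y z).
  move=> i j c ij ci cj.
  have i_eq : i = 2 by case: (label_two_parts ci) (label_two_parts cj) => ? [] ?; lia.
  have j_eq : j = k by case: (label_two_parts cj) => ?; lia.
  by subst i j; rewrite two_rows_2 two_rows_k; split_ifs; lia.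
have entP r c i : entry T r c i ->
    0 < c /\ (i = 2 /\ c <= p /\ r = (if c <= x then 2 else 1) \/
     i = k /\ c <= q /\ r = (if c <= y then k else if c <= z then 2 else 1)).
  case/hT=> i_gt0 c_le ->; split; first by lia.
  move: (c_le); case: (label_two_parts c_le) => -> {}c_le; [left | right].
    by rewrite two_rows_2; lia.
  by rewrite two_rows_k; lia.
have ent2 r c : 0 < c <= p -> r = (if c <= x then 2 else 1) -> entry T r c 2.
  by move=> c_le ->; apply/hT.
exists T => //; split; last first.
  move=> r [c /in_domf[i Ti]].
  have : r = 1 \/ r = 2 \/ r = k /\ i = k.
    by case/entP: (Ti : entry T r c i) => _; split_ifs => E; lia.
  case=> [->|[->|[rk ik]]]; last by left; exists c; subst r i; exact: Ti.
    (* The first 2 in row 1 and the last [k] in row 2; [x < z] puts them in the required order. *)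
    right; exists x.+1, z; split; last lia.
      by apply/in_domf; exists 2; apply: ent2; split_ifs; lia.
    apply/in_domf; exists k; apply/hT; rewrite two_rows_k.
    by split; split_ifs; lia.
  by left; exists 1; apply: ent2; split_ifs; lia.
split.
- move=> r c i /[dup] /hT[i_gt0 c_le _] /entP[c_gt0 E]; split=> //.
  by case: E => [[_ [_ ->]]|[_ [_ ->]]]; split_ifs => //; lia.
- exact: (has_rows_content hT).
- move=> i c i_gt0 c_le; exists (two_rows k x y z i c).
  by split=> [|r /hT[_ _ ->]]; first by apply/hT.
- by move=> r c i /entP[_]; split_ifs; lia.
- move=> i r c r' c' /entP[_ E] /entP[_ E'].
  by move: E E'; split_ifs; lia.
- move=> i j c ri rj ij /entP[_ E] /entP[_ E'].
  by move: E E'; split_ifs; lia.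
Qed.

Lemma not_multiplicity_free_two_parts : 2 < p < q -> ~ key_multiplicity_free a.
Proof.
move=> pq mf.
(* Both weights have 2 cells in row [k], [q - 1] in row 2 and [p - 1] in row 1; [p < q] gives
   [p <= z] even for [z = q - 1]. *)
have [||||T QT hT] := @two_rows_QKT 2 2 q.-1; try lia.
have [||||T' QT' hT'] := @two_rows_QKT 1 2 q; try lia.
have eqT : T = T'.
  apply: mf => //; apply/eq_in_map => r _.
  by rewrite (card_two_rows _ _ _ hT) ?(card_two_rows _ _ _ hT'); lia.
have /hT' [] : entry T' 2 2 2 by rewrite -eqT; apply/hT; split=> //; lia.
by rewrite two_rows_2.
Qed.

End TwoParts.

(** * From the composition to [sort] and [flat] *)

Lemma two_parts_after_zero a :
  size (flat a) = 2 -> part a 1 = 0 -> part a 2 <> 0 ->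
  exists k, [/\ 2 < k, 0 < part a k, flat a = [:: part a 2; part a k] &
    forall i, i != 2 -> i != k -> part a i = 0].
Proof.
case: a => [|a1 [|p b]] //; rewrite /part /= => + a1_0; rewrite a1_0 /flat /=.
move=> + p_neq0; have -> /= : p != 0 by apply/eqP.
case=> b_size.
have {b_size} [m [mb b_m b_supp]] : exists m,
    [/\ 0 < nth 0 b m, [seq x <- b | x != 0] = [:: nth 0 b m] &
        forall i, i != m -> nth 0 b i = 0].
  elim: b b_size => [//|x b IHb] /=; case: eqP => [-> /IHb[m [mb b_m b_supp]]|x_neq0 /=].
    by exists m.+1; split=> // -[|i] //= i_neq; apply: b_supp; lia.
  move=> [/size0nil b0]; exists 0; split=> /=; [lia | by rewrite b0 | ].
  move=> [//|i] _ /=; case: (ltnP i (size b)) => [i_lt|]; last exact: nth_default.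
  move/eqP: b0; rewrite -[_ == _]negbK -has_filter -all_predC.
  by move=> /(all_nthP 0)/(_ i i_lt)/=/negPn/eqP.
(* [m] counts from 0 in [b], which starts at the third part of [a], while parts count from 1. *)
exists m.+3; split=> //=; first by rewrite b_m.
move=> [|[|[|i]]] //= i_neq2 i_neqm; apply: b_supp; lia.
Qed.

Theorem theorem5p6 (a : seq nat)
    (two_parts : size (flat a) = 2)
    (leading_zero : part a 1 = 0 /\ part a 2 <> 0) :
  key_multiplicity_free a <->
  ([\/ sort_comp a = [:: 3; 3],
       sort_comp a = [:: 4; 4],
       (exists2 n, 4 <= n & sort_comp a = [:: n - 2; 2])
     | (exists2 n, 2 <= n & sort_comp a = [:: n - 1; 1])]
   \/ exists alpha1 alpha2 : nat,
        flat a = [:: alpha1; alpha2] /\ alpha1 >= alpha2).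
Proof.
case: leading_zero => a1_0 a2_neq0.
have [k [k_gt2 ak_gt0 flat_a a_supp]] := two_parts_after_zero two_parts a1_0 a2_neq0.
have a2_gt0 : 0 < part a 2 by lia.
have mfP : key_multiplicity_free a <-> part a k <= part a 2 \/ part a 2 <= 2.
  split=> [mf|]; last exact: multiplicity_free_two_parts.
  have [lt|] := boolP (2 < part a 2 < part a k); last lia.
  by case: (not_multiplicity_free_two_parts k_gt2 a2_gt0 ak_gt0 a_supp lt).
rewrite mfP /sort_comp flat_a.
move: (part a 2) (part a k) a2_gt0 ak_gt0 => p q p_gt0 q_gt0.
have sortE : sort geq [:: p; q] = if q <= p then [:: p; q] else [:: q; p].
  by rewrite /sort /=; case: leqP.
rewrite sortE; split=> [pq | []].
- case: (leqP q p) pq => [le_qp _ | lt_pq [|le_p2]]; [|lia|].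
    by right; exists p, q.
  left; have [p1|p2] : p = 1 \/ p = 2 by lia.
    by constructor 4; exists q.+1; [lia | rewrite p1 subSS subn0].
  by constructor 3; exists q.+2; [lia | rewrite p2 !subSS subn0].
(* For [p < q] the sorted parts are [q, p]: (3,3) and (4,4) are impossible, and the two families
   give [p = 2] and [p = 1]. *)
- by case: leqP => // lt_pq [[]|[]|[n _ []]|[n _ []]]; lia.
by move=> [_ [_ [[<- <-]]]]; left.
Qed.
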